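(* Let $X$ be a Hadamard space, $K\subseteq X$ closed and convex, $\theta\ge0$, and let $f:K\times K\to\mathbb{R}$ be a pseudo-monotone and $\theta$-under monotone bifunction such that $f(x,x)=0$ and $f(x,\cdot)$ is lower semicontinuous and convex for all $x\in K$. Suppose $S(f,K)\neq\varnothing$ and $f(\cdot,y)$ is $\Delta$-upper semicontinuous for all $y\in K$. Let $\{\lambda_k\}\subset(\theta,\bar\lambda]$ for some $\bar\lambda>\theta$, let $x_0\in X$, and let $\{x_k\}_{k\ge0}$ be a sequence with $x_{k+1}=J^f_{\lambda_k}x_k$ for all $k\geq 0$, that is, $x_{k+1}\in K$ and $$f(x_{k+1},y)+\lambda_k\langle\overrightarrow{x_kx_{k+1}},\overrightarrow{x_{k+1}y}\rangle\ge0\qquad\forall y\in K.$$ Then $\{x_k\}$ is $\Delta$-convergent to an element of $S(f,K)$.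
   Context: A Hadamard space is a complete CAT(0) space. Quasi-linearization: $\langle\overrightarrow{ab},\overrightarrow{cd}\rangle=\frac12\{d^2(a,d)+d^2(b,c)-d^2(a,c)-d^2(b,d)\}$ for $a,b,c,d\in X$. For a bounded sequence $\{x_k\}$ the asymptotic center is the set of minimizers over $x\in X$ of $\limsup_k d(x,x_k)$. $\{x_k\}$ $\Delta$-converges to $x$ if every subsequence of $\{x_k\}$ has asymptotic center $\{x\}$. Convexity of a function is along geodesics. $f$ is pseudo-monotone if $f(x,y)\ge0$ with $x,y\in K$ implies $f(y,x)\le0$; $\theta$-under monotone if $f(x,y)+f(y,x)\le\theta d^2(x,y)$ for all $x,y\in K$. $f(\cdot,y)$ is $\Delta$-upper semicontinuous if $\limsup_n f(x_n,y)\le f(x,y)$ whenever $\{x_n\}\subset K$ $\Delta$-converges to $x\in K$. $S(f,K)=\{x\in K: f(x,y)\ge0\ \forall y\in K\}$ is the set of equilibrium points. For $x\in X$ and $\lambda>\theta$, $J^f_\lambda x$ (the resolvent) denotes the point $z\in K$ with $f(z,y)+\lambda\langle\overrightarrow{xz},\overrightarrow{zy}\rangle\ge0$ for all $y\in K$ (such a $z$ is unique when it exists). *)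

(* Defs.v *)
From HB Require Import structures.
From mathcomp Require Import all_boot all_order all_algebra.
From mathcomp Require Import all_classical all_reals all_analysis.

Set Implicit Arguments.
Unset Strict Implicit.
Unset Printing Implicit Defensive.

Import Order.TTheory GRing.Theory Num.Theory.
Import numFieldNormedType.Exports.

Local Open Scope classical_set_scope.
Local Open Scope ring_scope.

#[short(type="completeMetricType")]
HB.structure Definition CompleteMetric (R : numDomainType) :=
  {T of Metric R T & Complete T}.

Section CAT0.
Context {R : realType}.

(* Constant-speed parametrization on [0, 1]: [c t] is the point usually written
   (1 - t)x (+) ty, and t |-> c (t / d(x, y)) is the unit-speed geodesic. *)
Definition geodesic {X : metricType R} (x y : X) (c : R -> X) : Prop :=
  [/\ c 0 = x, c 1 = y &
      forall s t, 0 <= s <= 1 -> 0 <= t <= 1 ->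
        mdist (c s) (c t) = `|s - t| * mdist x y].

(* The norm of the library on row vectors is the sup norm, hence this explicit
   Euclidean distance on the plane. *)
Definition plane_dist (p q : 'rV[R]_2) : R :=
  Num.sqrt (\sum_i (p ord0 i - q ord0 i) ^+ 2).

(* x lies on the side c of a geodesic triangle, and x' is the point of the
   comparison side [p', q'] at the same distance from p' as x is from p. *)
Definition comparison_on_side {X : metricType R} (c : R -> X)
    (p' q' : 'rV[R]_2) (x : X) (x' : 'rV[R]_2) : Prop :=
  exists2 t, 0 <= t <= 1 & x = c t /\ x' = p' + t *: (q' - p').

Definition CAT0 (X : metricType R) : Prop :=
  (forall x y : X, exists c, geodesic x y c) /\
  (forall (p q r : X) (cpq cqr crp : R -> X) (p' q' r' : 'rV[R]_2),
    geodesic p q cpq -> geodesic q r cqr -> geodesic r p crp ->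
    plane_dist p' q' = mdist p q ->
    plane_dist q' r' = mdist q r ->
    plane_dist r' p' = mdist r p ->
    let comparison x x' :=
      [\/ comparison_on_side cpq p' q' x x',
          comparison_on_side cqr q' r' x x' |
          comparison_on_side crp r' p' x x'] in
    forall x y x' y', comparison x x' -> comparison y y' ->
      mdist x y <= plane_dist x' y').

End CAT0.

Section Metric.
Context {R : realType} {X : metricType R}.

Definition convex_set_geo (K : set X) : Prop :=
  forall x y c t, K x -> K y -> geodesic x y c -> 0 <= t <= 1 -> K (c t).

Definition convex_on_geo (K : set X) (g : X -> R) : Prop :=
  forall x y c t, K x -> K y -> geodesic x y c -> 0 <= t <= 1 ->
    g (c t) <= (1 - t) * g x + t * g y.

(* [subspace K] carries the relative topology on K; the points outside K are
   isolated, so that only the restriction of g to K matters. *)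
Definition lsc_on (K : set X) (g : X -> R) : Prop :=
  lower_semicontinuous (fun y : subspace K => (g y)%:E).

Definition quasilin (a b c d : X) : R :=
  (mdist a d ^+ 2 + mdist b c ^+ 2 - mdist a c ^+ 2 - mdist b d ^+ 2) / 2.

Definition bounded_seq (u : nat -> X) : Prop :=
  exists M : R, forall m n, mdist (u m) (u n) <= M.

Definition asymptotic_radius (u : nat -> X) (x : X) : \bar R :=
  limn_esup (fun k => (mdist x (u k))%:E).

Definition asymptotic_center (u : nat -> X) : set X :=
  [set x | forall y, (asymptotic_radius u x <= asymptotic_radius u y)%E].

Definition delta_cvg (u : nat -> X) (x : X) : Prop :=
  bounded_seq u /\
  forall phi : nat -> nat, increasing_seq phi ->
    asymptotic_center (u \o phi) = [set x].

Definition delta_usc_on (K : set X) (g : X -> R) : Prop :=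
  forall (u : nat -> X) (x : X), (forall n, K (u n)) -> K x ->
    delta_cvg u x -> (limn_esup (fun n => (g (u n))%:E) <= (g x)%:E)%E.

(* A bifunction K x K -> R is represented by a total f : X -> X -> R of which
   only the values on K x K are used. *)
Implicit Types (f : X -> X -> R) (K : set X).

Definition pseudo_monotone f K : Prop :=
  forall x y, K x -> K y -> 0 <= f x y -> f y x <= 0.

Definition under_monotone (theta : R) f K : Prop :=
  forall x y, K x -> K y -> f x y + f y x <= theta * mdist x y ^+ 2.

Definition equilibria f K : set X :=
  [set x | K x /\ forall y, K y -> 0 <= f x y].

(* z is the resolvent J^f_lambda x *)
Definition is_resolvent f K (lambda : R) (x z : X) : Prop :=
  K z /\ forall y, K y -> 0 <= f z y + lambda * quasilin x z z y.

End Metric.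

(* Main.v *)
(** For an equilibrium p, pseudo-monotonicity gives f(x_{k+1}, p) <= 0, and the
    resolvent inequality at y = p then reads
    d(p, x_{k+1})^2 + d(x_k, x_{k+1})^2 <= d(p, x_k)^2.
    Hence the sequence is Fejer monotone and d(x_k, x_{k+1}) -> 0; since the
    lambda_k are bounded, the resolvent inequality at any y yields
    liminf f(x_k, y) >= 0, and upper semicontinuity makes every Delta-cluster
    point an equilibrium.  Bounded sequences have Delta-convergent subsequences
    (Lim's diagonal argument), and by Fejer monotonicity the limit of one of
    them is the asymptotic center of every subsequence. *)
Require Import Defs.
From HB Require Import structures.
From mathcomp Require Import all_boot all_order all_algebra.
From mathcomp Require Import all_classical all_reals all_analysis.
From mathcomp Require Import ring lra.

Set Implicit Arguments.
Unset Strict Implicit.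
Unset Printing Implicit Defensive.

Import Order.TTheory GRing.Theory Num.Theory.
Import numFieldNormedType.Exports.

Local Open Scope classical_set_scope.
Local Open Scope ring_scope.

(** * Comparison triangles in the plane and the Bruhat-Tits inequality *)

(** With two vertices at [(0, 0)] and [(a, 0)], the law of cosines dictates the abscissa of the
    third, and the triangle inequalities leave room for a real ordinate. The case [a = 0] is apart
    because that abscissa divides by [2 * a]. *)
Lemma plane_triangle (R : realType) (a b c : R) :
  0 <= a -> 0 <= b -> 0 <= c -> a <= b + c -> b <= a + c -> c <= a + b ->
  exists x y : R, x ^+ 2 + y ^+ 2 = c ^+ 2 /\ (x - a) ^+ 2 + y ^+ 2 = b ^+ 2.
Proof.
move=> a0 b0 c0 abc bac cab; have [aE|an0] := eqVneq a 0.
  by exists c, 0; rewrite (_ : b = c) ?aE ?subr0; [split; ring|lra].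
pose x := (a ^+ 2 + c ^+ 2 - b ^+ 2) / (2 * a).
have xE : 2 * a * x = a ^+ 2 + c ^+ 2 - b ^+ 2 by rewrite /x; field.
have agt0 : 0 < a by rewrite lt0r an0.
have x2 : 0 <= c ^+ 2 - x ^+ 2.
  have : 0 <= (c - x) * (c + x).
    (* Scaled by [2 * a], each factor splits, as in Heron's formula, into terms that the triangle
       inequalities make nonnegative. *)
    apply: mulr_ge0; rewrite -(pmulr_rge0 _ (_ : 0 < 2 * a)) ?mulr_gt0//.
      have -> : 2 * a * (c - x) = (b - a + c) * (b + a - c).
        by rewrite mulrBr xE; ring.
      by apply: mulr_ge0; lra.
    have -> : 2 * a * (c + x) = (a + c - b) * (a + c + b).
      by rewrite mulrDr xE; ring.
    by apply: mulr_ge0; lra.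
  by rewrite [_ * _](_ : _ = c ^+ 2 - x ^+ 2)//; ring.
exists x, (Num.sqrt (c ^+ 2 - x ^+ 2)); rewrite sqr_sqrtr//.
split; first by ring.
have -> : (x - a) ^+ 2 = x ^+ 2 - 2 * a * x + a ^+ 2 by ring.
by rewrite xE; ring.
Qed.

Section CAT0_geometry.
Context {R : realType} {X : metricType R}.
Implicit Types (x y z p q r : X) (c : R -> X) (t : R).

Definition plane_point (x y : R) : 'rV[R]_2 :=
  \row_j (if j == ord0 then x else y).

Lemma plane_dist_point (x y x' y' : R) :
  plane_dist (plane_point x y) (plane_point x' y') =
  Num.sqrt ((x - x') ^+ 2 + (y - y') ^+ 2).
Proof. by rewrite /plane_dist !big_ord_recl big_ord0 !mxE/= addr0. Qed.

(* The inequality of Bruhat and Tits, for all points of the side. *)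
Lemma CAT0_CN (hX : CAT0 X) x y z c t : geodesic x y c -> 0 <= t <= 1 ->
  mdist (c t) z ^+ 2 <= (1 - t) * mdist x z ^+ 2 + t * mdist y z ^+ 2
                        - t * (1 - t) * mdist x y ^+ 2.
Proof.
move=> gc t01; have [geo comp] := hX.
have [c2 gc2] := geo y z; have [c3 gc3] := geo z x.
have [u [v [uvx uvy]]] : exists u v : R, u ^+ 2 + v ^+ 2 = mdist z x ^+ 2 /\
    (u - mdist x y) ^+ 2 + v ^+ 2 = mdist y z ^+ 2.
  apply: plane_triangle; rewrite ?mdist_ge0//.
  - by rewrite addrC (metric_sym z x) (metric_sym y z) metric_triangle.
  - by rewrite (metric_sym x y) (metric_sym z x) metric_triangle.
  - by rewrite (metric_sym z x) metric_triangle.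
pose x' := plane_point 0 0; pose y' := plane_point (mdist x y) 0.
pose z' := plane_point u v.
have xy' : plane_dist x' y' = mdist x y.
  by rewrite plane_dist_point subr0 expr0n/= addr0 sub0r sqrrN sqrtr_sqr
    ger0_norm ?mdist_ge0.
have yz' : plane_dist y' z' = mdist y z.
  rewrite plane_dist_point sub0r sqrrN -(sqrrN (_ - u)) opprB uvy.
  by rewrite sqrtr_sqr ger0_norm ?mdist_ge0.
have zx' : plane_dist z' x' = mdist z x.
  by rewrite plane_dist_point !subr0 uvx sqrtr_sqr ger0_norm ?mdist_ge0.
have := comp _ _ _ _ _ _ _ _ _ gc gc2 gc3 xy' yz' zx' (c t) z
  (x' + t *: (y' - x')) z'.
have -> : x' + t *: (y' - x') = plane_point (t * mdist x y) 0.
  by apply/rowP => j; rewrite !mxE; case: ifP => _; ring.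
rewrite plane_dist_point sub0r sqrrN => H.
have {}H : mdist (c t) z <= Num.sqrt ((t * mdist x y - u) ^+ 2 + v ^+ 2).
  apply: H.
    apply: Or31; exists t => //; split=> //.
    by apply/rowP => j; rewrite !mxE; case: ifP => _; ring.
  (* The vertex [z] is the endpoint, at parameter 1, of the side from [y] to [z]. *)
  apply: Or32; exists 1; rewrite ?ler01 ?lexx//; split; first by case: gc2.
  by apply/rowP => j; rewrite !mxE; ring.
have : mdist (c t) z ^+ 2 <= (t * mdist x y - u) ^+ 2 + v ^+ 2.
  rewrite -[leRHS]sqr_sqrtr ?addr_ge0 ?sqr_ge0//.
  by rewrite lerXn2r ?nnegrE ?sqrtr_ge0 ?mdist_ge0.
(* In coordinates both sides of what remains are equal (Stewart's theorem). *)
move=> /le_trans; apply; rewrite (metric_sym x z) -uvx -uvy.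
by rewrite le_eqVlt; apply/orP; left; apply/eqP; ring.
Qed.

End CAT0_geometry.

(** * Epsilon characterizations of upper bounds *)

Lemma limn_esup_leP (R : realType) (v : nat -> R) (l : R) :
  (limn_esup (fun n => (v n)%:E) <= l%:E)%E <->
  forall e, 0 < e -> \forall n \near \oo, v n <= l + e.
Proof.
split=> [vl e e0|vl].
  have : (limn_esup (fun n => (v n)%:E) < (l + e)%:E)%E.
    by rewrite (le_lt_trans vl)// lte_fin ltrDl.
  move=> /ereal_inf_lt[_ [V Voo <-] Vle].
  apply: filterS Voo => n Vn; rewrite -lee_fin (le_trans _ (ltW Vle))//.
  by apply: ereal_sup_ubound; exists n.
apply/lee_addgt0Pr => e e0; apply: ge_ereal_inf.
exists (ereal_sup [set (v n)%:E | n in [set n | v n <= l + e]]).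
  by exists [set n | v n <= l + e] => //; exact: vl.
by apply: ge_ereal_sup => _ [n /= vn <-]; rewrite lee_fin.
Qed.

(** The extra assumption [e <= 1] allows errors quadratic in [e] to be absorbed into the linear term
    [C * e]. *)
Lemma ler_addgt0M (R : realFieldType) (C a b : R) :
  (forall e, 0 < e -> e <= 1 -> a <= b + C * e) -> a <= b.
Proof.
move=> H; apply/ler_addgt0Pr => e e0.
have C1 : 0 < `|C| + 1 by rewrite ltr_wpDl.
have e1 : 0 < Num.min 1 (e / (`|C| + 1)) by rewrite lt_min ltr01 divr_gt0.
apply: le_trans (H _ e1 _) _; first by rewrite ge_min lexx.
rewrite lerD2l (@le_trans _ _ ((`|C| + 1) * Num.min 1 (e / (`|C| + 1))))//.
  by rewrite ler_pM2r// (le_trans (ler_norm C))// lerDl.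
by rewrite mulrC -ler_pdivlMr// ge_min lexx orbT.
Qed.

(** * The asymptotic radius as a real-valued function *)

Section radius.
Context {R : realType} {X : metricType R}.
Implicit Types (u v : nat -> X) (x y z : X) (psi : nat -> nat).

(** [fine] sends infinite values to 0, but the radius of a bounded sequence is finite, so no
    information is lost there. *)
Definition radius u y : R := fine (asymptotic_radius u y).

Lemma bounded_seq_dist u y : bounded_seq u ->
  exists2 B : R, 0 <= B & forall n, mdist y (u n) <= B.
Proof.
move=> [M uM]; exists (mdist y (u 0%N) + M).
  by rewrite addr_ge0 ?mdist_ge0// (le_trans (mdist_ge0 (u 0%N) (u 0%N)) (uM _ _)).
by move=> n; rewrite (le_trans (metric_triangle _ (u 0%N) _))// lerD2l.
Qed.

Lemma bounded_seq_comp u psi : bounded_seq u -> bounded_seq (u \o psi).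
Proof. by move=> [M uM]; exists M => m n; exact: uM. Qed.

Lemma asymptotic_radiusE u y : bounded_seq u ->
  asymptotic_radius u y = (radius u y)%:E.
Proof.
move=> bu; rewrite fineK// ge0_fin_numE.
  have [B _ uB] := bounded_seq_dist y bu.
  apply: (@le_lt_trans _ _ B%:E); last by rewrite ltry.
  apply/limn_esup_leP => e e0; apply: nearW => n.
  by rewrite (le_trans (uB n))// lerDl ltW.
apply: limf_esup_ge0; last by move=> n; rewrite lee_fin mdist_ge0.
exact: filter_not_empty.
Qed.

Lemma radiusP u y (l : R) : bounded_seq u ->
  radius u y <= l <->
  forall e, 0 < e -> \forall n \near \oo, mdist y (u n) <= l + e.
Proof.
move=> bu; rewrite -lee_fin -asymptotic_radiusE//; exact: limn_esup_leP.
Qed.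

Lemma radius_near u y e : bounded_seq u -> 0 < e ->
  \forall n \near \oo, mdist y (u n) <= radius u y + e.
Proof. by move=> bu e0; move: e e0; apply/radiusP. Qed.

Lemma radius_ge0 u y : bounded_seq u -> 0 <= radius u y.
Proof.
move=> bu; apply/ler_addgt0Pr => e e0.
have /filter_ex[n] := radius_near y bu e0.
exact/le_trans/mdist_ge0.
Qed.

(** Reindexings are only asked to satisfy [n <= psi n], which is stable under composition and enough
    to compare limits superior. Equality from some index on is what a diagonal sequence provides. *)
Lemma radius_sub u v psi y : bounded_seq u -> bounded_seq v ->
  (forall n, (n <= psi n)%N) -> (\forall n \near \oo, v n = u (psi n)) ->
  radius v y <= radius u y.
Proof.
move=> bu bv psin vu; apply/radiusP => // e e0.
have [N _ uN] := radius_near y bu e0.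
near=> n; have -> : v n = u (psi n) by near: n.
apply: uN => /=; apply: leq_trans (psin n).
by near: n; exact: nbhs_infty_ge.
Unshelve. all: by end_near. Qed.

Lemma radius_comp u psi y : bounded_seq u -> (forall n, (n <= psi n)%N) ->
  radius (u \o psi) y <= radius u y.
Proof.
move=> bu psin; apply: (@radius_sub u _ psi) => //; last exact: nearW.
exact: bounded_seq_comp.
Qed.

Lemma radius_succ u y : bounded_seq u -> radius (u \o S) y = radius u y.
Proof.
move=> bu; have bS := bounded_seq_comp S bu.
apply/eqP; rewrite eq_le radius_comp//=; apply/radiusP => // e e0.
by apply: near_inftyS; exact: radius_near.
Qed.

Lemma radius_lip u y z : bounded_seq u ->
  radius u y <= mdist y z + radius u z.
Proof.
move=> bu; apply/radiusP => // e e0.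
apply: filterS (radius_near z bu e0) => n uz.
by rewrite (le_trans (metric_triangle _ z _))// -addrA lerD2l.
Qed.

(** Constant sequences make the metric projection a case of minimizing the radius. *)
Lemma radius_cst z y : radius (fun=> z) y = mdist y z.
Proof.
have bz : bounded_seq (fun _ : nat => z) by exists 0 => *; rewrite mdistxx.
apply/eqP; rewrite eq_le; apply/andP; split.
  by apply/radiusP => // e e0; apply: nearW => n; rewrite lerDl ltW.
apply/ler_addgt0Pr => e e0.
by have /filter_ex[n] := radius_near y bz e0.
Qed.

Lemma radius_CN (hX : CAT0 X) u x y c t : bounded_seq u ->
  geodesic x y c -> 0 <= t <= 1 ->
  radius u (c t) ^+ 2 <= (1 - t) * radius u x ^+ 2 + t * radius u y ^+ 2
                         - t * (1 - t) * mdist x y ^+ 2.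
Proof.
move=> bu gc t01; have /andP[t0 t1] := t01.
set rx := radius u x; set ry := radius u y; set d := mdist x y.
have rx0 : 0 <= rx by exact: radius_ge0.
have ry0 : 0 <= ry by exact: radius_ge0.
(* The constant comes from [(r + e) ^+ 2 <= r ^+ 2 + (2 * r + 1) * e], valid for [e <= 1], applied
   to both radii with weights [1 - t] and [t]. *)
apply: (@ler_addgt0M _ ((1 - t) * (2 * rx + 1) + t * (2 * ry + 1))) => e e0 e1.
pose B := (1 - t) * (rx + e) ^+ 2 + t * (ry + e) ^+ 2 - t * (1 - t) * d ^+ 2.
have near_bnd : \forall n \near \oo, mdist (c t) (u n) ^+ 2 <= B.
  near=> n; apply: le_trans (CAT0_CN hX (u n) gc t01) _.
  rewrite lerD2r lerD// ler_wpM2l ?subr_ge0// lerXn2r ?nnegrE ?mdist_ge0//.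
  - by rewrite addr_ge0// ltW.
  - by near: n; exact: radius_near.
  - by rewrite addr_ge0// ltW.
  - by near: n; exact: radius_near.
have B0 : 0 <= B.
  by have /filter_ex[n] := near_bnd; exact/le_trans/sqr_ge0.
apply: (@le_trans _ _ B).
  rewrite -[leRHS]sqr_sqrtr// lerXn2r ?nnegrE ?sqrtr_ge0 ?radius_ge0//.
  apply/radiusP => // e' e'0; apply: filterS near_bnd => n H.
  rewrite (@le_trans _ _ (Num.sqrt B))//; last by rewrite lerDl ltW.
  by rewrite -(@ger0_norm _ (mdist _ _)) ?mdist_ge0// -sqrtr_sqr ler_wsqrtr.
have He (r : R) : 0 <= r -> (r + e) ^+ 2 <= r ^+ 2 + (2 * r + 1) * e.
  move=> r0; have -> : (r + e) ^+ 2 = r ^+ 2 + 2 * r * e + e * e by ring.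
  have : e * e <= 1 * e by rewrite ler_wpM2r// ltW.
  by move=> ?; lra.
have := ler_wpM2l t0 (He _ ry0).
have := @ler_wpM2l _ (1 - t) _ _ _ (He _ rx0); rewrite subr_ge0 => /(_ t1).
rewrite /B => ? ?; lra.
Unshelve. all: by end_near. Qed.

End radius.

(** * Existence, uniqueness and location of asymptotic centers *)

Section asymptotic_centers.
Context {R : realType} {X : completeMetricType R} (hX : CAT0 X).
Implicit Types (u v : nat -> X) (x y z : X) (psi : nat -> nat) (K : set X).

(** This is the Bruhat-Tits inequality for the radius at the midpoint, multiplied by 4. It forces
    near-minimizers of the radius to be close to each other. *)
Lemma midpoint_gap u K (l : R) x y : bounded_seq u -> convex_set_geo K ->
  (forall z, K z -> l <= radius u z ^+ 2) -> K x -> K y ->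
  mdist x y ^+ 2 <= 2 * radius u x ^+ 2 + 2 * radius u y ^+ 2 - 4 * l.
Proof.
move=> bu Kconv lK Kx Ky; have [geo _] := hX; have [c gc] := geo x y.
have h01 : 0 <= (2^-1 : R) <= 1 by lra.
have := radius_CN hX bu gc h01; have := lK _ (Kconv _ _ _ _ Kx Ky gc h01).
by move=> ? ?; lra.
Qed.

(** A minimizing sequence is Cauchy by [midpoint_gap]; its limit stays in the closed set [K] and is
    a minimizer because the radius is 1-Lipschitz. *)
Lemma radius_min u K : bounded_seq u -> closed K -> convex_set_geo K ->
  K !=set0 -> exists2 p, K p & forall y, K y -> radius u p <= radius u y.
Proof.
move=> bu Kcl Kconv [x0 Kx0].
pose E := [set radius u z ^+ 2 | z in K].
have lbE : has_lbound E by exists 0 => _ [z _ <-]; exact: sqr_ge0.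
have infE : has_inf E by split => //; exists (radius u x0 ^+ 2); exists x0.
have lK z : K z -> inf E <= radius u z ^+ 2 by move=> Kz; apply: ge_inf => //; exists z.
have /choice[y_ y_P] (n : nat) : exists z,
    K z /\ radius u z ^+ 2 < inf E + n.+1%:R^-1.
  have n0 : 0 < n.+1%:R^-1 :> R by rewrite invr_gt0.
  by have [_ [z Kz <-] ?] := inf_adherent n0 infE; exists z.
have small e : 0 < e -> \forall n \near \oo,
    radius u (y_ n) ^+ 2 < inf E + e /\ n.+1%:R^-1 < e.
  move=> e0; have := near_infty_natSinv_lt (PosNum e0).
  by apply: filterS => n /= ne; split=> //; apply: lt_trans (y_P n).2 _; rewrite ltrD2l.
have /cauchy_cvg y_cvg : cauchy (y_ @ \oo).
  apply: cauchy_exP => e e0.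
  (* Two squared radii within [e ^+ 2 / 4] of the infimum give a squared distance below [e ^+ 2]. *)
  have e4 : 0 < e ^+ 2 / 4 by rewrite divr_gt0 ?exprn_gt0.
  have [N _ smallN] := small _ e4; exists (y_ N); exists N => // n /= Nn.
  rewrite ballEmdist /= -(@ltr_pXn2r _ 2)// ?nnegrE ?mdist_ge0 ?ltW//.
  apply: le_lt_trans (midpoint_gap bu Kconv lK (y_P N).1 (y_P n).1) _.
  have [? _] := smallN N (leqnn N); have [? _] := smallN n Nn.
  by lra.
pose p := lim (y_ @ \oo).
exists p.
  apply: (@closed_cvg _ _ _ _ y_ K Kcl _ p y_cvg).
  by apply: nearW => n; case: (y_P n).
(* One [e] pays for the distance from [p] to [y_ n], the other for the excess of the radius at
   [y_ n]. *)
move=> z Kz; apply/(@ler_addgt0M _ 2) => e e0 _.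
have e20 : 0 < e ^+ 2 by rewrite exprn_gt0.
have near_p : \forall n \near \oo, mdist p (y_ n) < e.
  by apply: metricType_numDomainType.cvgr_dist_lt e0.
have [n [pn [yn _]]] := filter_ex (filterI near_p (small _ e20)).
apply: le_trans (radius_lip p (y_ n) bu) _.
suff : radius u (y_ n) <= radius u z + e by move=> ?; lra.
have z0 := radius_ge0 z bu.
rewrite -(@ler_pXn2r _ 2)// ?nnegrE ?radius_ge0 ?addr_ge0 ?(ltW e0)//.
have := lK _ Kz; have := mulr_ge0 z0 (ltW e0).
by move=> ? ?; rewrite sqrrD mulr2n; lra.
Qed.

Lemma radius_min_unique u x y : bounded_seq u ->
  (forall z, radius u x <= radius u z) -> (forall z, radius u y <= radius u z) ->
  x = y.
Proof.
move=> bu xmin ymin; apply: mdist_positivity; apply/eqP.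
rewrite -sqrf_eq0 eq_le sqr_ge0 andbT.
have xy : radius u y = radius u x by apply/eqP; rewrite eq_le xmin ymin.
have := @midpoint_gap u setT (radius u x ^+ 2) x y bu.
rewrite xy => H; apply: le_trans (H _ _ _ _) _ => //; last by lra.
by move=> z _; rewrite lerXn2r// nnegrE radius_ge0.
Qed.

Lemma asymptotic_centerE u x : bounded_seq u ->
  (forall z, radius u x <= radius u z) -> asymptotic_center u = [set x].
Proof.
move=> bu xmin; apply/seteqP; split=> [y /= ymin|_ ->].
  apply: (@radius_min_unique u) => // z.
  by have := ymin z; rewrite !asymptotic_radiusE// lee_fin.
by move=> y; rewrite !asymptotic_radiusE// lee_fin.
Qed.

(** The nearest point [p] is compared with the point at parameter [t] of the geodesic from [p] to
    [z]; dividing the Bruhat-Tits inequality by [t] and letting [t] tend to 0 gives the Pythagorean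
    bound. *)
Lemma projection K x : closed K -> convex_set_geo K -> K !=set0 ->
  exists2 p, K p & forall z, K z -> mdist x p ^+ 2 + mdist p z ^+ 2 <= mdist x z ^+ 2.
Proof.
move=> Kcl Kconv K0.
have bx : bounded_seq (fun _ : nat => x) by exists 0 => *; rewrite mdistxx.
have [p Kp pmin] := radius_min bx Kcl Kconv K0.
exists p => // z Kz; have [geo _] := hX; have [c gc] := geo p z.
apply/(@ler_addgt0M _ (mdist p z ^+ 2)) => t t0 t1.
have t01 : 0 <= t <= 1 by rewrite ltW.
have := pmin _ (Kconv _ _ _ _ Kp Kz gc t01); rewrite !radius_cst => pc.
have := CAT0_CN hX x gc t01.
have : mdist p x ^+ 2 <= mdist (c t) x ^+ 2 by rewrite lerXn2r ?nnegrE ?mdist_ge0.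
rewrite (metric_sym p x) (metric_sym z x) => ? ?.
rewrite -(ler_pM2l t0); lra.
Qed.

(** Projecting [x] onto [K] brings it no farther from any [u n], so the projection is also a
    minimizer, and minimizers are unique. This keeps Delta-limits in [K]. *)
Lemma radius_min_in u K x : bounded_seq u -> closed K -> convex_set_geo K ->
  (forall n, K (u n)) -> (forall z, radius u x <= radius u z) -> K x.
Proof.
move=> bu Kcl Kconv uK xmin.
have [|p Kp px] := @projection K x Kcl Kconv; first by exists (u 0%N).
suff <- : p = x by [].
apply: (@radius_min_unique u) => // z; apply: le_trans (xmin z).
apply/radiusP => // e e0; apply: filterS (radius_near x bu e0) => n.
apply: le_trans; rewrite -(@ler_pXn2r _ 2)// ?nnegrE ?mdist_ge0//.
by apply: le_trans (px _ (uK n)); rewrite lerDr sqr_ge0.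
Qed.

End asymptotic_centers.

(** * Delta-convergent subsequences and Fejer monotone sequences *)

Lemma increasing_seq_ge (phi : nat -> nat) :
  increasing_seq phi -> forall n, (n <= phi n)%N.
Proof.
move=> phi_inc; elim=> // n /leq_ltn_trans; apply.
have := phi_inc n.+1 n; rewrite !leEnat ltnn => /negbT.
by rewrite -ltnNge.
Qed.

Section delta_compactness.
Context {R : realType} {X : completeMetricType R} (hX : CAT0 X).
Implicit Types (u v : nat -> X) (x y z : X) (psi : nat -> nat).

Definition min_radius u : R := inf (range (radius u)).

Lemma has_inf_radius u : bounded_seq u -> has_inf (range (radius u)).
Proof.
move=> bu; split; first by exists (radius u (u 0%N)); exists (u 0%N).
by exists 0 => _ [z _ <-]; exact: radius_ge0.
Qed.

Lemma min_radius_le u y : bounded_seq u -> min_radius u <= radius u y.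
Proof. by move=> /has_inf_radius[_ lb]; apply: ge_inf => //; exists y. Qed.

Lemma min_radius_sub u v psi : bounded_seq u -> bounded_seq v ->
  (forall n, (n <= psi n)%N) -> (\forall n \near \oo, v n = u (psi n)) ->
  min_radius v <= min_radius u.
Proof.
move=> bu bv psin vu; apply: lb_le_inf; first by case: (has_inf_radius bu).
move=> _ [z _ <-]; apply: le_trans (min_radius_le z bv) _.
exact: (radius_sub _ bu bv psin vu).
Qed.

(** [psi] is chosen to nearly minimize [min_radius] among all reindexings of [u]; [psi \o chi] is
    another competitor. *)
Lemma almost_regular u (e : R) : bounded_seq u -> 0 < e ->
  exists psi, (forall n, (n <= psi n)%N) /\
    forall chi : nat -> nat, (forall n, (n <= chi n)%N) ->
      min_radius (u \o psi) <= min_radius (u \o psi \o chi) + e.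
Proof.
move=> bu e0.
pose E := [set min_radius (u \o psi) | psi in [set psi | forall n, (n <= psi n)%N]].
have infE : has_inf E.
  split; first by exists (min_radius u), id.
  exists 0 => _ [psi _ <-]; have bpsi := bounded_seq_comp psi bu.
  apply: lb_le_inf; first by case: (has_inf_radius bpsi).
  by move=> _ [z _ <-]; exact: radius_ge0.
have [_ [psi psin <-] psie] := inf_adherent e0 infE.
exists psi; split=> // chi chin; apply: le_trans (ltW psie) _; rewrite lerD2r.
apply: ge_inf; first by case: infE.
by exists (psi \o chi) => // n /=; exact: leq_trans (chin n) (psin _).
Qed.

(* Diagonal of nested subsequences, the n-th one being 1/(n+1)-regular. *)
Lemma regular_subsequence u : bounded_seq u ->
  exists2 psi, (forall n, (n <= psi n)%N) &
    forall chi : nat -> nat, (forall n, (n <= chi n)%N) ->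
      min_radius (u \o psi) <= min_radius (u \o psi \o chi).
Proof.
move=> bu.
have /choice[next nextP] (a : nat * (nat -> nat)) : exists psi : nat -> nat,
    (forall n, (n <= psi n)%N) /\
    forall chi : nat -> nat, (forall n, (n <= chi n)%N) ->
      min_radius (u \o a.2 \o psi) <=
      min_radius (u \o a.2 \o psi \o chi) + a.1.+1%:R^-1.
  by apply: almost_regular; [exact: bounded_seq_comp|rewrite invr_gt0].
(* The stage [m] is passed along with the map, so that [F m.+1] refines [F m] and is regular up to
   [m.+1%:R^-1]. *)
pose F := fix F n := if n is m.+1 then F m \o next (m, F m) else id.
have F_ge n m : (m <= F n m)%N.
  elim: n m => //= n IH m.
  by apply: leq_trans (IH _); exact: (nextP (n, F n)).1.
have F_sub k n : exists2 chi : nat -> nat,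
    (forall m, (m <= chi m)%N) & F (k + n)%N = F n \o chi.
  elim: k => [|k [chi chin FE]]; first by exists id.
  exists (chi \o next ((k + n)%N, F (k + n)%N)); last by rewrite addSn /= {1}FE.
  move=> m /=; apply: leq_trans (chin _); exact: (nextP (_, _)).1.
pose d n := F n n; exists d; first by move=> n; exact: F_ge.
have d_sub n : exists2 rho : nat -> nat, (forall m, (m <= rho m)%N) &
    forall m, (n <= m)%N -> d m = F n (rho m).
  (* The diagonal is a reindexing of [F n] only from rank [n] on; below it [rho m] is an arbitrary
     index, taken to be [m]. *)
  have /choice[rho rhoP] (m : nat) : exists r,
      (m <= r)%N /\ ((n <= m)%N -> d m = F n r).
    have [nm|mn] := leqP n m; last by exists m.
    have [chi chin FE] := F_sub (m - n)%N n; exists (chi m); split=> // _.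
    by rewrite /d; move: FE; rewrite subnK// => ->.
  by exists rho => m; [case: (rhoP m)|case: (rhoP m)].
move=> chi chin; apply/ler_addgt0Pr => e e0.
have [n /ltW ne] := filter_ex (near_infty_natSinv_lt (PosNum e0)).
have [rho rhon dE] := d_sub n.+1.
have bF := bounded_seq_comp (F n.+1) bu; have bd := bounded_seq_comp d bu.
apply: (@le_trans _ _ (min_radius (u \o F n.+1))).
  apply: (@min_radius_sub _ _ rho) => //.
  by exists n.+1 => // m /= nm; rewrite dE.
have rc m : (m <= (rho \o chi) m)%N by exact: leq_trans (chin m) (rhon _).
apply: le_trans ((nextP (n, F n)).2 _ rc) _; apply: lerD => //.
(* From rank [n.+1] on, [F n.+1 \o rho \o chi] and [d \o chi] agree, so [id] suffices as
   reindexing. *)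
apply: (@min_radius_sub _ _ id) => //; try exact: bounded_seq_comp.
exists n.+1 => // m /= nm; rewrite dE//; exact: leq_trans nm (chin m).
Qed.

(** Along a regular subsequence the minimal radius cannot drop under further extraction, while the
    radius at a fixed point cannot grow; the minimizer [q] is thus the center of every further
    subsequence. *)
Lemma delta_subsequence u : bounded_seq u ->
  exists psi q, (forall n, (n <= psi n)%N) /\ delta_cvg (u \o psi) q.
Proof.
move=> bu; have [psi psin reg] := regular_subsequence bu.
have bpsi := bounded_seq_comp psi bu.
have [|//||q _ qmin] := @radius_min _ _ hX (u \o psi) setT bpsi.
- exact: closedT.
- by exists (u 0%N).
exists psi, q; split=> //; split=> // phi /increasing_seq_ge phin.
have bphi := bounded_seq_comp phi bpsi.
apply: (asymptotic_centerE hX) => // z.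
apply: le_trans (radius_comp q bpsi phin) _.
apply: le_trans (min_radius_le z bphi); apply: le_trans (reg phi phin).
apply: lb_le_inf; first by case: (has_inf_radius bpsi).
by move=> _ [y _ <-]; exact: qmin.
Qed.

Lemma delta_cvg_min u q z : delta_cvg u q -> radius u q <= radius u z.
Proof.
move=> [bu uq]; have : asymptotic_center u q.
  by have -> : asymptotic_center u = [set q] by exact: (uq id).
by move=> /(_ z); rewrite !asymptotic_radiusE// lee_fin.
Qed.

(** The distances to [p] are nonincreasing, so their limit superior is a limit, shared by all
    subsequences. *)
Lemma radius_comp_monotone u psi p : bounded_seq u ->
  (forall m n, (m <= n)%N -> mdist p (u n) <= mdist p (u m)) ->
  (forall n, (n <= psi n)%N) -> radius (u \o psi) p = radius u p.
Proof.
move=> bu pu psin; have bpsi := bounded_seq_comp psi bu.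
apply/eqP; rewrite eq_le radius_comp//=; apply/radiusP => // e e0.
have /filter_ex[N HN] := radius_near p bpsi e0.
exists (psi N) => // n /= /pu; by move=> /le_trans; exact.
Qed.

Lemma fejer_delta_cvg u (S : set X) : bounded_seq u ->
  (forall p, S p -> forall m n, (m <= n)%N -> mdist p (u n) <= mdist p (u m)) ->
  (forall psi q, (forall n, (n <= psi n)%N) -> delta_cvg (u \o psi) q -> S q) ->
  exists2 p, S p & forall psi, (forall n, (n <= psi n)%N) ->
    forall z, radius (u \o psi) p <= radius (u \o psi) z.
Proof.
move=> bu fejer cluster.
have center psi : (forall n, (n <= psi n)%N) -> exists2 q, S q &
    forall z, radius u q <= radius (u \o psi) z.
  move=> psin; have bpsi := bounded_seq_comp psi bu.
  have [chi [q [chin uq]]] := delta_subsequence bpsi.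
  have pcn n : (n <= (psi \o chi) n)%N by exact: leq_trans (chin n) (psin _).
  have Sq : S q by exact: cluster uq.
  exists q => // z; apply: le_trans (radius_comp z bpsi chin).
  by rewrite -(radius_comp_monotone bu (fejer _ Sq) pcn); exact: delta_cvg_min.
(* [p] comes from the whole sequence and [q] from the given subsequence: [p] does at least as well
   as [q] on [u], and extraction leaves the radius at [p] unchanged. *)
have [//|p Sp pmin] := center id; exists p => // psi psin z.
have [q Sq qmin] := center _ psin.
rewrite (radius_comp_monotone bu (fejer _ Sp) psin).
exact: le_trans (pmin q) (qmin z).
Qed.

End delta_compactness.

(** * Fejer monotonicity and asymptotic behavior of the resolvent iterates *)

Section proximal_sequence.
Context {R : realType} {X : metricType R} (K : set X) (f : X -> X -> R).
Context (lambda : nat -> R) (lambdabar : R) (x : nat -> X).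
Context (f_pseudo : pseudo_monotone f K)
  (lambda_in : forall k, 0 < lambda k <= lambdabar)
  (x_step : forall k, is_resolvent f K (lambda k) (x k) (x k.+1)).

Lemma resolvent_fejer p k : equilibria f K p ->
  mdist p (x k.+1) ^+ 2 + mdist (x k) (x k.+1) ^+ 2 <= mdist p (x k) ^+ 2.
Proof.
move=> [Kp Sp]; have [Kx /(_ p Kp)] := x_step k.
have fp := f_pseudo Kp Kx (Sp _ Kx); have /andP[l0 _] := lambda_in k.
move=> H; have : 0 <= lambda k * quasilin (x k) (x k.+1) (x k.+1) p.
  by apply: le_trans H _; rewrite gerDr.
rewrite pmulr_rge0// /quasilin mdistxx expr0n/=.
rewrite (metric_sym (x k) p) (metric_sym (x k.+1) p); lra.
Qed.

Lemma resolvent_fejer_le p m n : equilibria f K p -> (m <= n)%N ->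
  mdist p (x n) <= mdist p (x m).
Proof.
move=> Sp mn; have dec k : mdist p (x k.+1) <= mdist p (x k).
  rewrite -(@ler_pXn2r _ 2)// ?nnegrE ?mdist_ge0//.
  by apply: le_trans (resolvent_fejer k Sp); rewrite lerDl sqr_ge0.
by have /nonincreasing_seqP := dec; apply.
Qed.

(** Once the squared distance to [p] is within [e ^+ 2] of its infimum, its later decreases, which
    dominate the squared steps, are below [e ^+ 2]. *)
Lemma resolvent_step_small p (e : R) : equilibria f K p -> 0 < e ->
  \forall k \near \oo, mdist (x k) (x k.+1) <= e.
Proof.
move=> Sp e0; pose D := range (fun k => mdist p (x k) ^+ 2).
have lbD : has_lbound D by exists 0 => _ [k _ <-]; exact: sqr_ge0.
have infD : has_inf D by split => //; exists (mdist p (x 0%N) ^+ 2); exists 0%N.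
have e20 : 0 < e ^+ 2 by rewrite exprn_gt0.
have [_ [N _ <-] /= DN] := inf_adherent e20 infD.
exists N => // k /= /(resolvent_fejer_le Sp) Nk.
have Dk : inf D <= mdist p (x k.+1) ^+ 2 by apply: ge_inf => //; exists k.+1.
have Nk2 : mdist p (x k) ^+ 2 <= mdist p (x N) ^+ 2.
  by rewrite lerXn2r ?nnegrE ?mdist_ge0.
have := resolvent_fejer k Sp.
rewrite -(@ler_pXn2r _ 2)// ?nnegrE ?mdist_ge0 ?(ltW e0)//.
by move=> ?; lra.
Qed.

Lemma resolvent_bounded p : equilibria f K p -> bounded_seq x.
Proof.
move=> Sp; exists (2 * mdist p (x 0%N)) => m n.
have := metric_triangle (x m) p (x n); rewrite (metric_sym (x m) p).
have := resolvent_fejer_le Sp (leq0n m); have := resolvent_fejer_le Sp (leq0n n).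
by lra.
Qed.

Lemma resolvent_liminf_ge0 p y (e : R) : equilibria f K p -> K y -> 0 < e ->
  \forall k \near \oo, - e <= f (x k.+1) y.
Proof.
move=> Sp Ky e0; have [B B0 xB] := bounded_seq_dist y (resolvent_bounded Sp).
have lb0 : 0 < lambdabar by have /andP[l0 /(lt_le_trans l0)] := lambda_in 0%N.
(* [B + 1] replaces [B], which may be 0, to keep the divisor positive. *)
have C0 : 0 < lambdabar * (B + 1) by rewrite mulr_gt0// ltr_wpDl.
have eC0 : 0 < e / (lambdabar * (B + 1)) by rewrite divr_gt0.
apply: filterS (resolvent_step_small Sp eC0) => k; rewrite ler_pdivlMr//.
set s := mdist _ _ => se; have [_ /(_ y Ky)] := x_step k.
have /andP[l0 lb] := lambda_in k.
have s0 : 0 <= s by exact: mdist_ge0.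
have b0 : 0 <= mdist (x k.+1) y by exact: mdist_ge0.
have bB : mdist (x k.+1) y <= B by rewrite metric_sym.
have : quasilin (x k) (x k.+1) (x k.+1) y <= s * (B + 1).
  (* This instance of the Cauchy-Schwarz inequality follows from the triangle inequality alone,
     since the two vectors share the point [x k.+1]. *)
  apply: (@le_trans _ _ (s * mdist (x k.+1) y)); last by rewrite ler_wpM2l//; lra.
  have : mdist (x k) y ^+ 2 <= (s + mdist (x k.+1) y) ^+ 2.
    by rewrite lerXn2r ?nnegrE ?mdist_ge0 ?addr_ge0// metric_triangle.
  by rewrite /quasilin mdistxx expr0n/= -/s sqrrD mulr2n; lra.
move=> /(ler_wpM2l (ltW l0)) H1 H2.
have : lambda k * (s * (B + 1)) <= lambdabar * (s * (B + 1)).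
  by rewrite ler_wpM2r// mulr_ge0//; lra.
move: se; rewrite mulrCA => se H3; have := le_trans H1 (le_trans H3 se).
by move: H2; set a := lambda k * _ => ? ?; lra.
Qed.

End proximal_sequence.

Theorem theorem3p22 (R : realType) (X : completeMetricType R) (hX : CAT0 X)
    (K : set X) (K_closed : closed K) (K_convex : convex_set_geo K)
    (theta : R) (theta_ge0 : 0 <= theta)
    (f : X -> X -> R)
    (f_pseudo : pseudo_monotone f K)
    (f_under : under_monotone theta f K)
    (f_diag : forall x, K x -> f x x = 0)
    (f_lsc : forall x, K x -> lsc_on K (f x))
    (f_convex : forall x, K x -> convex_on_geo K (f x))
    (S_nonempty : equilibria f K !=set0)
    (f_usc : forall y, K y -> delta_usc_on K (fun x => f x y))
    (lambdabar : R) (lambdabar_gt : theta < lambdabar)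
    (lambda : nat -> R) (lambda_in : forall k, theta < lambda k <= lambdabar)
    (x : nat -> X)
    (x_step : forall k, is_resolvent f K (lambda k) (x k) (x k.+1)) :
  exists2 p : X, equilibria f K p & delta_cvg x p.
Proof.
have lambda_pos k : 0 < lambda k <= lambdabar.
  by have /andP[/(le_lt_trans theta_ge0) -> ->] := lambda_in k.
have [p0 Sp0] := S_nonempty.
have bx : bounded_seq x by exact: resolvent_bounded Sp0.
(* The starting point [x 0] may lie outside [K], hence the shifted sequence. *)
have Kx n : K ((x \o S) n) by case: (x_step n).
have cluster psi q : (forall n, (n <= psi n)%N) ->
    delta_cvg (x \o S \o psi) q -> equilibria f K q.
  move=> psin xq.
  have bxp : bounded_seq (x \o S \o psi) by case: xq.
  have Kq : K q.
    apply: (radius_min_in hX bxp K_closed K_convex) => [n|z]; first exact: Kx.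
    exact: delta_cvg_min.
  (* One [e] comes from the eventual lower bound on [f] along the iterates, the other from upper
     semicontinuity at [q]. *)
  split=> // y Ky; apply/(@ler_addgt0M _ 2) => e e0 _.
  have /limn_esup_leP/(_ _ e0) :=
    f_usc y Ky _ q (fun n => Kx (psi n)) Kq xq.
  have [N _ HN] := resolvent_liminf_ge0 f_pseudo lambda_pos x_step Sp0 Ky e0.
  move=> [M _ HM].
  have := HM (maxn N M) (leq_maxr _ _).
  have := HN (psi (maxn N M)) (leq_trans (leq_maxl _ _) (psin _)).
  by rewrite /=; lra.
have bxS : bounded_seq (x \o S) by exact: bounded_seq_comp.
have fejer p : equilibria f K p -> forall m n, (m <= n)%N ->
    mdist p ((x \o S) n) <= mdist p ((x \o S) m).
  by move=> Sp m n mn; exact: (resolvent_fejer_le f_pseudo lambda_pos x_step Sp).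
have [p Sp pmin] := fejer_delta_cvg hX bxS fejer cluster.
exists p => //; split=> // phi /increasing_seq_ge phin.
have bphi := bounded_seq_comp phi bx.
apply: (asymptotic_centerE hX) => // z.
(* Dropping the first term makes all indices [phi n.+1] positive, so the subsequence of [x] becomes
   a reindexing of [x \o S] by their predecessors. *)
rewrite -!(radius_succ _ bphi).
have -> : (x \o phi) \o S = (x \o S) \o (predn \o phi \o S).
  by apply/funext => n /=; rewrite prednK// (leq_trans _ (phin n.+1)).
by apply: pmin => n /=; rewrite -ltnS prednK ?phin// (leq_trans _ (phin n.+1)).
Qed.
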